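(* Let $\mathcal{M}=\{M^x:x\in\mathcal{I}\}$ be a standard log-convex weight matrix, let $\omega_{\mathcal{M}}=\{\omega_{M^x}:x\in\mathcal{I}\}$ be the matrix of associated weight functions and $\mathcal{M}^{(2)}=\{M^{x;l}:x\in\mathcal{I},l>0\}$. Below, $x,y$ range over $\mathcal{I}$. (I) The following conditions are equivalent: (i) $\forall h>1\ \forall x\ \exists y:\ \limsup_{t\to+\infty}\frac{\omega_{M^y}(ht)}{\omega_{M^x}(t)}<+\infty$. (ii) $\forall x\ \exists y:\ \limsup_{t\to+\infty}\frac{\omega_{M^y}(2t)}{\omega_{M^x}(t)}<+\infty$. (iii) $\exists r>1\ \forall x\ \exists y\ \exists L\in\mathbb{N}_{>0}:\ \liminf_{j\to+\infty}\frac{(M^y_{Lj})^{1/(Lj)}}{(M^x_j)^{1/j}}>r$. (iv) $\forall r>1\ \forall x\ \exists y\ \exists L\in\mathbb{N}_{>0}:\ \liminf_{j\to+\infty}\frac{(M^y_{Lj})^{1/(Lj)}}{(M^x_j)^{1/j}}>r$. (v) $\forall x\ \forall C>1\ \exists y\ \exists B>0\ \forall a>0\ \exists D>0\ \forall j\in\mathbb{N}:\ C^jM^{x;a}_j\le D\,M^{y;Ba}_j$. (vi) $\forall x\ \forall C>1\ \forall a>0\ \exists y\ \exists b>0\ \exists D>0\ \forall j\in\mathbb{N}:\ C^jM^{x;a}_j\le D\,M^{y;b}_j$. (vii) $\forall r>1\ \forall x\ \exists y\ \exists b>0:\ \liminf_{j\to+\infty,\,j\in\mathbb{N}_{>0}}\frac{\exp(\frac{1}{bj}\varphi^*_{\omega_{M^y}}(bj))}{\exp(\frac1j\varphi^*_{\omega_{M^x}}(j))}>r$.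 (viii) $\forall r>1\ \forall x\ \exists y\ \exists b>0:\ \liminf_{j\to+\infty,\,j\in\mathbb{R}_{>0}}\frac{\exp(\frac{1}{bj}\varphi^*_{\omega_{M^y}}(bj))}{\exp(\frac1j\varphi^*_{\omega_{M^x}}(j))}>r$. (II) The following conditions are equivalent: (i) $\forall h>1\ \forall x\ \exists y:\ \limsup_{t\to+\infty}\frac{\omega_{M^x}(ht)}{\omega_{M^y}(t)}<+\infty$. (ii) $\forall x\ \exists y:\ \limsup_{t\to+\infty}\frac{\omega_{M^x}(2t)}{\omega_{M^y}(t)}<+\infty$. (iii) $\exists r>1\ \forall x\ \exists y\ \exists L\in\mathbb{N}_{>0}:\ \liminf_{j\to+\infty}\frac{(M^x_{Lj})^{1/(Lj)}}{(M^y_j)^{1/j}}>r$. (iv) $\forall r>1\ \forall x\ \exists y\ \exists L\in\mathbb{N}_{>0}:\ \liminf_{j\to+\infty}\frac{(M^x_{Lj})^{1/(Lj)}}{(M^y_j)^{1/j}}>r$. (v) $\forall x\ \forall C>1\ \exists y\ \exists B>0\ \forall a>0\ \exists D>0\ \forall j\in\mathbb{N}:\ C^jM^{y;a/B}_j\le D\,M^{x;a}_j$. (vi) $\forall x\ \forall C>1\ \forall a>0\ \exists y\ \exists b>0\ \exists D>0\ \forall j\in\mathbb{N}:\ C^jM^{y;b}_j\le D\,M^{x;a}_j$. (vii) $\forall r>1\ \forall x\ \exists y\ \exists b>0:\ \liminf_{j\to+\infty,\,j\in\mathbb{N}_{>0}}\frac{\exp(\frac1j\varphi^*_{\omega_{M^x}}(j))}{\exp(\frac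 bj\varphi^*_{\omega_{M^y}}(j/b))}>r$. (viii) $\forall r>1\ \forall x\ \exists y\ \exists b>0:\ \liminf_{j\to+\infty,\,j\in\mathbb{R}_{>0}}\frac{\exp(\frac1j\varphi^*_{\omega_{M^x}}(j))}{\exp(\frac bj\varphi^*_{\omega_{M^y}}(j/b))}>r$.
   Context: $\mathbb{N}=\{0,1,2,\dots\}$, $\mathcal{I}=\mathbb{R}_{>0}$. A sequence $M=(M_j)_{j\in\mathbb{N}}$ of positive reals is normalized if $1=M_0\le M_1$, and log-convex if $M_j^2\le M_{j-1}M_{j+1}$ for all $j\ge1$. $\mathcal{LC}$ is the set of normalized, log-convex $M$ with $\lim_j(M_j)^{1/j}=+\infty$. A weight matrix is a family $\mathcal{M}=\{M^x:x\in\mathcal{I}\}$ of normalized nondecreasing sequences with $M^x_j\le M^y_j$ for all $j$ whenever $x\le y$; it is standard log-convex if all $M^x\in\mathcal{LC}$. The associated function of $M\in\mathcal{LC}$ is $\omega_M(t)=\sup_{j\in\mathbb{N}}\log(t^j/M_j)$ for $t>0$, $\omega_M(0)=0$. For $\omega=\omega_M$ put $\varphi_\omega(y)=\omega(e^y)$ and $\varphi^*_\omega(x)=\sup_{y\ge0}\{xy-\varphi_\omega(y)\}$ for $x\ge0$. For $x\in\mathcal{I}$, $l>0$, $j\in\mathbb{N}$ put $M^{x;l}_j=\exp\big(\frac1l\varphi^*_{\omega_{M^x}}(lj)\big)$. *)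

(* Defs.v *)
From mathcomp Require Import all_boot all_order all_algebra.
From mathcomp Require Import all_classical all_reals all_analysis.
Import Order.TTheory GRing.Theory Num.Theory numFieldNormedType.Exports.

Set Implicit Arguments.
Unset Strict Implicit.
Unset Printing Implicit Defensive.

Local Open Scope classical_set_scope.
Local Open Scope ring_scope.

Section WeightSequences.
Context {R : realType}.
Implicit Types (M : nat -> R) (w : R -> R).

Definition positive_seq M := forall j, 0 < M j.

Definition normalized M := M 0%N = 1 /\ 1 <= M 1%N.

Definition log_convex M := forall j, M j.+1 ^+ 2 <= M j * M j.+2.

Definition LC M :=
  [/\ positive_seq M, normalized M, log_convex M &
      (M j `^ (j%:R)^-1) @[j --> \oo] --> +oo].

(* The suprema below are taken in R; the real [sup] has the junk value 0 on
   sets without a supremum, which does not occur for [M] in [LC]: since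
   M_j^(1/j) -> +oo, the sets in [omega M] and in [phi_star (omega M) x]
   (for x >= 0) are nonempty and bounded above. *)
Definition omega M (t : R) : R :=
  if 0 < t then sup [set ln (t ^+ j / M j) | j in [set: nat]] else 0.

Definition phi w (y : R) : R := w (expR y).

Definition phi_star w (x : R) : R :=
  sup [set x * y - phi w y | y in [set y : R | 0 <= y]].

(* [dual_seq (M x) l] is the sequence M^{x;l}. *)
Definition dual_seq M (l : R) (j : nat) : R :=
  expR (l^-1 * phi_star (omega M) (l * j%:R)).

(* The index set is R_{>0}: values [M x] with x <= 0 are unconstrained and
   every quantifier over indices is relativised to 0 < x. *)
Definition weight_matrix (M : R -> nat -> R) :=
  (forall x : R, 0 < x ->
     [/\ positive_seq (M x), normalized (M x) & nondecreasing_seq (M x)]) /\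
  (forall x y : R, 0 < x -> x <= y -> forall j, M x j <= M y j).

Definition standard_log_convex (M : R -> nat -> R) :=
  weight_matrix M /\ forall x : R, 0 < x -> LC (M x).

End WeightSequences.

(* Main.v *)
Require Import Defs.
From mathcomp Require Import all_boot all_order all_algebra.
From mathcomp Require Import all_classical all_reals all_analysis.
From mathcomp Require Import ring lra.
Import Order.TTheory GRing.Theory Num.Theory numFieldNormedType.Exports.
Local Open Scope classical_set_scope.
Local Open Scope ring_scope.

Set Implicit Arguments.
Unset Strict Implicit.
Unset Printing Implicit Defensive.

(** Write phi*_M for [phi_star (omega M)].  Log-convexity of M gives tangent
    lines to j |-> ln M_j, hence phi*_M(j) = ln M_j for integers j; moreover
    phi*_M(s)/s ([rate M s]) is nondecreasing in s.  By Young's inequality, a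
    bound omega_N(k t) <= L omega_M(t) + D for all t >= 1 amounts to
    phi*_N(L s) + D >= L phi*_M(s) + L s ln k for all s >= 0, that is, up to
    an arbitrarily small loss in k, to
    rate N (L s) >= rate M s + ln k for large s ([dominates]).  In each part,
    all eight conditions express that every x admits a y with this domination
    between M^x and M^y, by some fixed shift or by every shift; domination is
    transitive with shifts adding up, so iterating along x, y_1, y_2, ...
    turns one positive shift into all of them.  Monotonicity of the rate
    allows passing between integer and real arguments. *)

(** * Limits inferior and superior against eventual bounds *)

Section LimitBounds.
Context {R : realType} {T : choiceType} {X : filteredType T}.
Context (F : set_system X) {FF : Filter F}.

Lemma limf_einf_gt_near (f : X -> \bar R) (r : \bar R) :
  (r < limf_einf f F)%E -> \forall x \near F, (r < f x)%E.
Proof.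
rewrite limf_einfE => /ereal_sup_gt[_ [V FV <-] rV].
apply: filterS FV => x Vx; apply: lt_le_trans rV _.
by apply: ereal_inf_lbound; exists x.
Qed.

Lemma near_limf_einf_ge (f : X -> \bar R) (r : \bar R) :
  (\forall x \near F, (r <= f x)%E) -> (r <= limf_einf f F)%E.
Proof.
move=> rf; rewrite limf_einfE.
apply: (@le_trans _ _ (ereal_inf [set f x | x in [set x | (r <= f x)%E]])).
  by apply: le_ereal_inf_tmp => _ [x /= rfx <-].
by apply: ereal_sup_ubound; exists [set x | (r <= f x)%E].
Qed.

Lemma limf_esup_lt_near (f : X -> \bar R) (r : \bar R) :
  (limf_esup f F < r)%E -> \forall x \near F, (f x < r)%E.
Proof.
move=> /ereal_inf_lt[_ [V FV <-] rV].
apply: filterS FV => x Vx; apply: le_lt_trans rV.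
by apply: ereal_sup_ubound; exists x.
Qed.

Lemma near_limf_esup_le (f : X -> \bar R) (r : \bar R) :
  (\forall x \near F, (f x <= r)%E) -> (limf_esup f F <= r)%E.
Proof.
move=> rf.
apply: (@le_trans _ _ (ereal_sup [set f x | x in [set x | (f x <= r)%E]])).
  by apply: ereal_inf_lbound; exists [set x | (f x <= r)%E].
by apply: ge_ereal_sup => _ [x /= rfx <-].
Qed.

Lemma limf_einf_expR_gt (f g : X -> R) (r : R) : 0 < r ->
  (r%:E < limf_einf (fun x => (expR (f x) / expR (g x))%:E) F)%E ->
  \forall x \near F, g x + ln r <= f x.
Proof.
move=> r0 /limf_einf_gt_near; apply: filterS => x.
rewrite lte_fin -expRB => /ltW.
by rewrite -[X in X <= _]lnK ?posrE// ler_expR; lra.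
Qed.

(** A limit inferior preserves only weak bounds, so the strict conclusion is paid for by the gap
    between [ln r] and [h]. *)
Lemma near_limf_einf_expR (f g : X -> R) (r h : R) : 0 < r -> ln r < h ->
  (\forall x \near F, g x + h <= f x) ->
  (r%:E < limf_einf (fun x => (expR (f x) / expR (g x))%:E) F)%E.
Proof.
move=> r0 rh fg; apply: (@lt_le_trans _ _ (expR h)%:E).
  by rewrite lte_fin -[X in X < _]lnK ?posrE// ltr_expR.
apply: near_limf_einf_ge; apply: filterS fg => x gfx.
by rewrite lee_fin -expRB ler_expR; lra.
Qed.

End LimitBounds.

(** * A single log-convex sequence: tangents, associated function, conjugate *)

Section LC.
Context {R : realType}.
Implicit Types (M N : nat -> R).

Definition log_slope M j : R := ln (M j.+1) - ln (M j).

(** For [M] in [LC], extends the logarithm of the root M_j^(1/j) from integers j to real s. *)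
Definition rate M (s : R) : R := s^-1 * phi_star (omega M) s.

Section OneSequence.
Variable M : nat -> R.
Hypothesis MLC : LC M.

Let M_gt0 j : 0 < M j. Proof. by case: MLC => + _ _ _; apply. Qed.

Lemma log_slope_nondecreasing : {homo log_slope M : j k / (j <= k)%N >-> j <= k}.
Proof.
apply: homo_leq => [//|y x z|j]; first exact: le_trans.
case: MLC => _ _ /(_ j) + _; rewrite -ler_ln ?posrE ?exprn_gt0 ?mulr_gt0//.
rewrite lnXn// lnM ?posrE// /log_slope mulr2n; lra.
Qed.

Lemma log_slope_ge0 j : 0 <= log_slope M j.
Proof.
apply: le_trans (log_slope_nondecreasing (leq0n j)).
by case: MLC => _ [M0 M1] _ _; rewrite /log_slope M0 ln1 subr0 ln_ge0.
Qed.

Lemma ln_seq_ge0 j : 0 <= ln (M j).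
Proof.
elim: j => [|j IH]; first by case: MLC => _ [-> _] _ _; rewrite ln1.
by have := log_slope_ge0 j; rewrite /log_slope; lra.
Qed.

(** The increments of ln M_j are nondecreasing: those from j on are at least the slope at j, those
    before j at most. Summing them from j up to k, or from k up to j, gives the two cases. *)
Lemma ln_seq_tangent j k : ln (M j) + (k%:R - j%:R) * log_slope M j <= ln (M k).
Proof.
case: (leqP j k) => [jk|/ltnW kj].
  rewrite -(subnK jk); elim: (k - j)%N => [|n IH]; first by rewrite add0n; lra.
  have := log_slope_nondecreasing (leq_addl n j).
  by rewrite addSn -natr1 {2}/log_slope; move: IH; lra.
suff: ln (M j) <= ln (M k) + (j%:R - k%:R) * log_slope M j by lra.
have : forall n, (n + k <= j)%N ->
    ln (M (n + k)%N) <= ln (M k) + n%:R * log_slope M j.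
  elim=> [|n IH] nk; first by rewrite add0n; lra.
  have := log_slope_nondecreasing (ltnW nk); rewrite {1}/log_slope.
  by have := IH (ltnW nk); rewrite addSn -natr1; lra.
by move=> /(_ (j - k)%N); rewrite subnK// natrB//; apply.
Qed.

(** Since M_j^(1/j) tends to infinity, the terms are nonpositive from some J on; the earlier ones
    are at most J|y|. This makes the supremum in [omega] a genuine one. *)
Lemma ln_seq_superlinear (y : R) :
  exists B : R, forall j, j%:R * y - ln (M j) <= B.
Proof.
case: MLC => _ _ _ /cvgryPge /(_ (expR y)) [J _ HJ].
exists (J%:R * `|y|) => j; case: (leqP J j) => [Jj|/ltnW jJ]; last first.
  have := ln_seq_ge0 j.
  have : j%:R * y <= J%:R * `|y|.
    apply: (@le_trans _ _ (j%:R * `|y|)); first by rewrite ler_wpM2l ?ler_norm.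
    by rewrite ler_wpM2r ?ler_nat.
  by lra.
apply: (@le_trans _ _ 0); last by rewrite mulr_ge0.
(* The index 0 is apart: its root has exponent 0^-1 = 0 and carries no information. *)
case: j Jj => [_|j Jj]; first by have := ln_seq_ge0 0; lra.
have := HJ _ Jj; rewrite -[X in _ <= X -> _]lnK ?posrE ?powR_gt0// ler_expR.
by rewrite ln_powR ler_pdivlMl// => ?; lra.
Qed.

Let lnE (y : R) j : ln (expR y ^+ j / M j) = j%:R * y - ln (M j).
Proof. by rewrite -expRM_natl ln_div ?posrE ?expR_gt0// expRK. Qed.

Lemma omega_expR_ge (y : R) j : j%:R * y - ln (M j) <= omega M (expR y).
Proof.
rewrite /omega expR_gt0 -lnE; apply: ub_le_sup; last by exists j.
have [B HB] := ln_seq_superlinear y; exists B => _ [k _ <-]; rewrite lnE.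
exact: HB.
Qed.

Lemma omega_expR_le (y B : R) : (forall j, j%:R * y - ln (M j) <= B) ->
  omega M (expR y) <= B.
Proof.
move=> HB; rewrite /omega expR_gt0; apply: ge_sup.
  by exists (ln (expR y ^+ 0 / M 0%N)), 0%N.
by move=> _ [k _ <-]; rewrite lnE.
Qed.

Lemma omega_expR_ge0 (y : R) : 0 <= omega M (expR y).
Proof.
have := omega_expR_ge y 0.
by case: MLC => _ [-> _] _ _; rewrite ln1 mul0r subr0.
Qed.

Lemma omega_expR_nondecreasing :
  {homo (fun y : R => omega M (expR y)) : y z / y <= z}.
Proof.
move=> y z yz; apply: omega_expR_le => j.
by apply: le_trans (omega_expR_ge z j); rewrite lerD2r ler_wpM2l.
Qed.

Lemma omega_expR0 : omega M (expR 0) = 0.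
Proof.
apply/eqP; rewrite eq_le omega_expR_ge0 andbT.
by apply: omega_expR_le => j; have := ln_seq_ge0 j; lra.
Qed.

Lemma young (x y : R) : 0 <= x -> 0 <= y ->
  x * y - omega M (expR y) <= phi_star (omega M) x.
Proof.
move=> x0 y0; rewrite /phi_star; apply: ub_le_sup; last by exists y.
(* With n the integer part of x plus one, x z <= n z, and the n-th term of [omega] bounds n z -
   omega by ln M_n. *)
exists (ln (M (Num.truncn x).+1)) => _ [z /= z0 <-].
have := omega_expR_ge z (Num.truncn x).+1; rewrite /phi.
have : x * z <= (Num.truncn x).+1%:R * z.
  by rewrite ler_wpM2r// ltW// truncnS_gt.
lra.
Qed.

Lemma phi_star_le (x B : R) :
  (forall y, 0 <= y -> x * y - omega M (expR y) <= B) ->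
  phi_star (omega M) x <= B.
Proof.
move=> HB; apply: ge_sup; last by move=> _ [y /= y0 <-]; exact: HB.
by exists (x * 0 - phi (omega M) 0), 0 => /=.
Qed.

(** The supremum is attained at y = [log_slope M j]: by the tangent inequality, index j realises
    [omega] there. *)
Lemma phi_star_nat j : phi_star (omega M) j%:R = ln (M j).
Proof.
apply/eqP; rewrite eq_le; apply/andP; split.
  by apply: phi_star_le => y _; have := omega_expR_ge y j; lra.
apply: le_trans (@young j%:R (log_slope M j) (ler0n _ _) (log_slope_ge0 j)).
suff: omega M (expR (log_slope M j)) <= j%:R * log_slope M j - ln (M j) by lra.
by apply: omega_expR_le => k; have := ln_seq_tangent j k; lra.
Qed.

Lemma phi_star_ge0 (x : R) : 0 <= x -> 0 <= phi_star (omega M) x.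
Proof. by move=> /young/(_ (lexx 0)); rewrite omega_expR0 mulr0 subr0. Qed.

Lemma phi_starE (s : R) : 0 < s -> phi_star (omega M) s = s * rate M s.
Proof. by move=> s0; rewrite /rate mulVKf ?gt_eqF. Qed.

(** As [omega] is nonnegative and s/t <= 1, each s y - omega is at most (s/t)(t y - omega). *)
Lemma rate_nondecreasing (s t : R) : 0 < s -> s <= t -> rate M s <= rate M t.
Proof.
move=> s0 st; have t0 : 0 < t by lra.
rewrite /rate ler_pdivrMl//; apply: phi_star_le => y y0.
have := young (ltW t0) y0; have := omega_expR_ge0 y.
set w := omega _ _; set p := phi_star _ _ => w0 yp.
have u1 : s / t <= 1 by rewrite ler_pdivrMr// mul1r.
have u0 : 0 <= s / t by rewrite divr_ge0 ?ltW.
rewrite mulrA; apply: le_trans (ler_wpM2l u0 yp).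
rewrite mulrBr mulrA divfK ?gt_eqF// lerB// ler_piMl//.
Qed.

(** True also at j = 0, where the convention 0^-1 = 0 makes both sides 1. *)
Lemma powR_root_rate j : M j `^ (j%:R)^-1 = expR (rate M j%:R).
Proof. by rewrite /rate phi_star_nat /powR gt_eqF. Qed.

End OneSequence.

(** * Domination of rates, and its global, integer and real forms *)

(** The scale [L] is an unspecified positive real, so that one relation covers integer dilations of
    roots, the parameters of dual sequences and multiplicative constants in front of [omega]. *)
Definition dominates (h : R) N M :=
  exists L s0 : R, [/\ 0 < L, 0 < s0 &
    forall s, s0 <= s -> rate M s + h <= rate N (L * s)].

Lemma dominates_trans (h k : R) N K M :
  dominates h N K -> dominates k K M -> dominates (h + k) N M.
Proof.
move=> [L [s1 [L0 s10 H1]]] [L' [s2 [L'0 s20 H2]]].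
(* Scales multiply; the threshold [s1 / L'] puts [L' * s] in the range of the first domination. *)
exists (L * L'), (Num.max s2 (s1 / L')); split.
- exact: mulr_gt0.
- by rewrite lt_max s20.
- move=> s; rewrite ge_max => /andP[/H2 ks]; rewrite ler_pdivrMr// mulrC.
  by move=> /H1; rewrite mulrA; lra.
Qed.

Lemma dominates_le (h k : R) N M : h <= k -> dominates k N M -> dominates h N M.
Proof.
by move=> hk [L [s0 [L0 s00 H]]]; exists L, s0; split=> // s /H; lra.
Qed.

(** Beyond [s0], multiply the domination by L s. Below it, the left side is monotone in s, so its
    value at [s0] serves as the constant [D]. *)
Lemma dominates_global (h : R) N M : LC N -> LC M -> 0 <= h ->
  dominates h N M ->
  exists L D : R, 0 < L /\ forall s, 0 <= s ->
    L * phi_star (omega M) s + L * s * h <= phi_star (omega N) (L * s) + D.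
Proof.
move=> NLC MLC h0 [L [s0 [L0 s00 H]]].
have p0 := phi_star_ge0 MLC (ltW s00).
exists L, (L * phi_star (omega M) s0 + L * s0 * h); split=> // s sge0.
have := phi_star_ge0 NLC (mulr_ge0 (ltW L0) sge0).
case: (leP s0 s) => [ss0|/ltW ss0] ?.
  have sp : 0 < s by lra.
  have := H s ss0.
  rewrite -(@ler_pM2l _ (L * s)) ?mulr_gt0//.
  rewrite (@phi_starE N) ?mulr_gt0// (@phi_starE M s)//.
  have : 0 <= L * phi_star (omega M) s0 by rewrite mulr_ge0// ltW.
  have : 0 <= L * s0 * h by rewrite !mulr_ge0// ltW.
  by lra.
have : L * s * h <= L * s0 * h by rewrite ler_wpM2r// ler_wpM2l// ltW.
suff : L * phi_star (omega M) s <= L * phi_star (omega M) s0 by lra.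
rewrite ler_wpM2l ?(ltW L0)//; apply: phi_star_le => // y y0.
apply: le_trans (young MLC (ltW s00) y0).
by rewrite lerD2r ler_wpM2r.
Qed.

(** After division by L s the error D/(L s) is absorbed by k - h for large s. *)
Lemma global_dominates (h k L D : R) N M : h < k -> 0 < L ->
  (forall s, 0 <= s ->
    L * phi_star (omega M) s + L * s * k <= phi_star (omega N) (L * s) + D) ->
  dominates h N M.
Proof.
move=> hk L0 H.
exists L, (Num.max 1 (D / (L * (k - h)))); split=> //.
  by rewrite lt_max ltr01.
move=> s; rewrite ge_max ler_pdivrMr ?mulr_gt0 ?subr_gt0// => /andP[s1 sD].
have s0 : 0 < s by lra.
rewrite -(@ler_pM2l _ (L * s)) ?mulr_gt0//.
have := H s (ltW s0); rewrite (@phi_starE N) ?mulr_gt0// (@phi_starE M)//.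
by lra.
Qed.

(** For real s >= a, rounding s/a up to an integer j gives s <= a j <= 2 s. Monotonicity of both
    rates then costs only a factor 2 in the scale and nothing in the shift. *)
Lemma nat_dominates (a b h : R) N M : LC N -> LC M -> 0 < a -> 0 < b ->
  (\forall j \near \oo, rate M (a * j%:R) + h <= rate N (b * j%:R)) ->
  dominates h N M.
Proof.
move=> NLC MLC a0 b0 [J _ HJ].
exists (2 * b / a), (Num.max a (a * J%:R)); split.
- by rewrite divr_gt0// mulr_gt0.
- by rewrite lt_max a0.
move=> s; rewrite ge_max => /andP[sa saJ]; have s0 : 0 < s by lra.
pose j := (Num.truncn (s / a)).+1.
have /andP[js sj] := @truncn_itv _ (s / a) (divr_ge0 (ltW s0) (ltW a0)).
have {}js : a * j%:R <= 2 * s.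
  move: js; rewrite ler_pdivlMr// /j -natr1; lra.
have {}sj : s <= a * j%:R by move: sj; rewrite ltr_pdivrMr// mulrC => /ltW.
have Jj : (J <= j)%N by rewrite -(ler_nat R) -(ler_pM2l a0) (le_trans saJ).
have j0 : 0 < j%:R :> R by rewrite ltr0n.
have := HJ j Jj; have := rate_nondecreasing MLC s0 sj.
suff : rate N (b * j%:R) <= rate N (2 * b / a * s) by lra.
apply: rate_nondecreasing; rewrite ?mulr_gt0//.
have -> : 2 * b / a * s = b * (2 * s / a) by ring.
by rewrite ler_pM2l// ler_pdivlMr// mulrC.
Qed.

Lemma real_dominates (a b h : R) N M : 0 < a -> 0 < b ->
  (\forall s \near +oo, rate M (a * s) + h <= rate N (b * s)) ->
  dominates h N M.
Proof.
move=> a0 b0 [s0 [_ H]].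
exists (b / a), (a * Num.max 1 (s0 + 1)); split.
- exact: divr_gt0.
- by rewrite mulr_gt0// lt_max ltr01.
move=> s; rewrite mulrC -ler_pdivlMr// ge_max => /andP[_ ss].
have /H : s0 < s / a by lra.
by rewrite [a * _]mulrC divfK ?gt_eqF// mulrCA mulrC mulrAC.
Qed.

(** [L] is fixed before a and b, so the scaling may be put on either side: a = 1, b = L, or a = 1/L,
    b = 1. *)
Lemma dominates_near (h : R) N M : dominates h N M ->
  exists L : R, 0 < L /\ forall a b : R, 0 < a -> b = L * a ->
    \forall s \near +oo, rate M (a * s) + h <= rate N (b * s).
Proof.
move=> [L [s0 [L0 s00 H]]]; exists L; split=> // a b a0 ->.
near=> s; rewrite -mulrA; apply: H; rewrite mulrC -(ler_pdivrMr _ _ a0).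
by near: s; apply: nbhs_pinfty_ge; rewrite num_real.
Unshelve. all: by end_near. Qed.

Lemma dominates_near_nat (h : R) N M : LC N -> dominates h N M ->
  exists L : nat, (0 < L)%N /\
    \forall j \near \oo, rate M j%:R + h <= rate N (L * j)%:R.
Proof.
(* Rounding the scale up to an integer only increases the rate of [N]. *)
move=> NLC [L [s0 [L0 s00 H]]]; exists (Num.truncn L).+1; split=> //.
near=> j.
have sj : s0 <= j%:R.
  by near: j; exact: nbhs_infty_ger.
apply: le_trans (H _ sj) _; apply: rate_nondecreasing => //.
  by rewrite mulr_gt0//; lra.
by rewrite natrM ler_wpM2r// ltW// truncnS_gt.
Unshelve. all: by end_near. Qed.

(** * Growth of associated functions against domination *)

Lemma omega_ge1_near M : LC M -> \forall t \near +oo, 1 <= omega M t.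
Proof.
move=> MLC; near=> t.
have t1 : expR (1 + ln (M 1%N)) <= t.
  by near: t; apply: nbhs_pinfty_ge; rewrite num_real.
have t0 : 0 < t by apply: lt_le_trans t1; exact: expR_gt0.
have := omega_expR_ge MLC (ln t) 1; rewrite lnK ?posrE//.
by move: t1; rewrite -[X in _ <= X -> _]lnK ?posrE// ler_expR; lra.
Unshelve. all: by end_near. Qed.

(** The finite limit superior gives omega_N(k t) <= L omega_M(t) + D. Young's inequality for [N] at
    L s and ln k + y, then the supremum over y, yields the global bound with shift ln k. *)
Lemma omega_dominates (k h : R) N M : LC N -> LC M -> 1 < k -> h < ln k ->
  (limf_esup (fun t : R => (omega N (k * t) / omega M t)%:E) +oo%R < +oo)%E ->
  dominates h N M.
Proof.
move=> NLC MLC k1 hk fin.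
have [K /limf_esup_lt_near nearK] : exists K : R,
    (limf_esup (fun t : R => (omega N (k * t) / omega M t)%:E) +oo%R < K%:E)%E.
  move: fin; case: limf_esup => [r _|//|_]; last by exists 0; rewrite ltNyr.
  by exists (r + 1); rewrite lte_fin ltrDl.
have [t0 [_ H]] := filterI nearK (omega_ge1_near MLC).
have k0 : 0 < k by lra.
pose u := ln (Num.max 1 (t0 + 1)).
(* [D] controls the range y <= u, where the limit superior says nothing; the maximum with 1 keeps
   [L] positive. *)
pose L := Num.max 1 K; pose D := omega N (expR (ln k + u)).
have L0 : 0 < L by rewrite lt_max ltr01.
have D0 : 0 <= D by exact: omega_expR_ge0.
have shift y : omega N (expR (ln k + y)) <= L * omega M (expR y) + D.
  have w0 := omega_expR_ge0 MLC y.
  case: (leP y u) => yu.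
    have : omega N (expR (ln k + y)) <= D.
      by apply: omega_expR_nondecreasing => //; rewrite lerD2l.
    have : 0 <= L * omega M (expR y) by rewrite mulr_ge0 // ltW.
    by lra.
  have t0y : t0 < expR y.
    move: yu; rewrite -ltr_expR lnK ?posrE ?lt_max ?ltr01// gt_max.
    by case/andP; lra.
  have [] := H _ t0y; rewrite lte_fin => + w1.
  rewrite ltr_pdivrMr; last by lra.
  rewrite expRD lnK ?posrE//.
  have : K * omega M (expR y) <= L * omega M (expR y).
    by rewrite ler_wpM2r// le_max lexx orbT.
  by lra.
apply: (@global_dominates _ (ln k) L D) => // s s0.
suff : phi_star (omega M) s <=
    L^-1 * (phi_star (omega N) (L * s) + D) - s * ln k.
  rewrite -(ler_pM2l L0) mulrBr mulVKf ?gt_eqF// mulrA.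
  by lra.
apply: phi_star_le => // y y0.
rewrite -(ler_pM2l L0) [X in _ <= X]mulrBr mulVKf ?gt_eqF//.
have Ls0 : 0 <= L * s by rewrite mulr_ge0 // ltW.
have ky0 : 0 <= ln k + y by rewrite addr_ge0 // ln_ge0 // ltW.
have := young NLC Ls0 ky0; have := shift y; lra.
Qed.

Lemma dominates_omega (k : R) N M : LC N -> LC M -> 1 < k ->
  dominates (ln k) N M ->
  (limf_esup (fun t : R => (omega N (k * t) / omega M t)%:E) +oo%R < +oo)%E.
Proof.
move=> NLC MLC k1 /(dominates_global NLC MLC).
rewrite ln_ge0 ?ltW// => /(_ erefl)[L [D [L0 H]]].
apply: le_lt_trans (ltry (L + `|D|)).
apply: near_limf_esup_le; near=> t; rewrite lee_fin.
have t1 : 1 <= t by near: t; apply: nbhs_pinfty_ge; rewrite num_real.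
have w1 : 1 <= omega M t by near: t; exact: omega_ge1_near.
have t0 : 0 < t by lra.
have k0 : 0 < k by lra.
have y0 : 0 <= ln t by rewrite ln_ge0.
rewrite ler_pdivrMr; last by lra.
(* Since [omega M t] is at least 1, D is absorbed into |D| times it. *)
apply: (@le_trans _ _ (L * omega M t + D)); last first.
  rewrite mulrDl lerD2l (le_trans (ler_norm _))// ler_peMr//.
rewrite -[k * t]lnK ?posrE ?mulr_gt0//; apply: omega_expR_le => // j.
rewrite -(phi_star_nat NLC) lnM ?posrE//.
(* At s = j/L the global bound involves [phi_star] of [N] at the integer j, which is ln N_j; Young's
   inequality for [M] at the same s bounds the j-th term of [omega N]. *)
have jL : 0 <= j%:R / L :> R by rewrite divr_ge0// ltW.
have := H _ jL; have := young MLC jL y0; rewrite lnK ?posrE//.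
rewrite -(ler_pM2l L0) mulrBr !mulrA ![L * _ / L]mulrAC divff ?gt_eqF// mul1r.
by lra.
Unshelve. all: by end_near. Qed.

(** * Dual sequences against domination *)

(** This is the global bound at s = a j divided by L a: the scale B = L is independent of a, and
    only the constant depends on it. *)
Lemma dominates_dual (C : R) N M : LC N -> LC M -> 1 < C ->
  dominates (ln C) N M -> exists B : R, 0 < B /\ forall a : R, 0 < a ->
    exists D : R, 0 < D /\
    forall j, C ^+ j * dual_seq M a j <= D * dual_seq N (B * a) j.
Proof.
move=> NLC MLC C1 /(dominates_global NLC MLC).
rewrite ln_ge0 ?ltW// => /(_ erefl)[L [D [L0 H]]].
exists L; split=> // a a0; exists (expR (D / (L * a))).
split; first exact: expR_gt0.
move=> j; rewrite /dual_seq -[X in X ^+ j]lnK ?posrE; last by lra.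
rewrite -expRM_natl -!expRD ler_expR.
have La : 0 < L * a by rewrite mulr_gt0.
rewrite -(ler_pM2l La) !mulrDr [D / _]mulrC !mulVKf ?gt_eqF//.
have := H (a * j%:R) (mulr_ge0 (ltW a0) (ler0n _ _)).
rewrite -(mulrA L a (a^-1 * _)) mulVKf ?gt_eqF//.
rewrite !mulrA; lra.
Qed.

(** Taking logarithms and dividing by j leaves the shift ln C - ln D / j, which is at least h for
    large j. *)
Lemma dual_dominates (a b C D h : R) N M : LC N -> LC M -> 0 < a -> 0 < b ->
  0 < C -> 0 < D -> h < ln C ->
  (forall j, C ^+ j * dual_seq M a j <= D * dual_seq N b j) ->
  dominates h N M.
Proof.
move=> NLC MLC a0 b0 C0 D0 hC H; apply: (nat_dominates _ _ a0 b0) => //.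
near=> j.
have j0 : 0 < j%:R :> R.
  by rewrite ltr0n; near: j; exact: nbhs_infty_gt.
have jD : ln D / (ln C - h) <= j%:R.
  by near: j; exact: nbhs_infty_ger.
move: jD; rewrite ler_pdivrMr ?subr_gt0// => jD.
have := H j; rewrite /dual_seq !phi_starE ?mulr_gt0//.
rewrite -[X in X ^+ j]lnK ?posrE// -[X in _ <= X * _]lnK ?posrE//.
rewrite -expRM_natl -!expRD ler_expR -!(mulrA _ j%:R) !mulKf ?gt_eqF// => ?.
by rewrite -(ler_pM2l j0); lra.
Unshelve. all: by end_near. Qed.

(** * Quotients of roots and of rates against domination *)

Lemma roots_dominates (r : R) (L : nat) N M : LC N -> LC M -> 0 < r ->
  (0 < L)%N ->
  (r%:E < limn_einf (fun j : nat =>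
     (N (L * j)%N `^ ((L * j)%:R)^-1 / M j `^ (j%:R)^-1)%:E))%E ->
  dominates (ln r) N M.
Proof.
move=> NLC MLC r0 L0; under eq_fun do rewrite !powR_root_rate//.
move=> /(limf_einf_expR_gt r0).
under eq_near do rewrite natrM -[X in rate M X]mul1r.
by apply: nat_dominates; rewrite ?ltr0n.
Qed.

Lemma dominates_roots (r h : R) N M : LC N -> LC M -> 0 < r -> ln r < h ->
  dominates h N M -> exists L : nat, (0 < L)%N /\
  (r%:E < limn_einf (fun j : nat =>
     (N (L * j)%N `^ ((L * j)%:R)^-1 / M j `^ (j%:R)^-1)%:E))%E.
Proof.
move=> NLC MLC r0 rh /(dominates_near_nat NLC)[L [L0 H]]; exists L; split=> //.
under eq_fun do rewrite !powR_root_rate//.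
exact: near_limf_einf_expR r0 rh H.
Qed.

Lemma rates_nat_dominates (a b r : R) N M : LC N -> LC M -> 0 < a -> 0 < b ->
  0 < r ->
  (r%:E < limn_einf (fun j : nat =>
     (expR (rate N (b * j%:R)) / expR (rate M (a * j%:R)))%:E))%E ->
  dominates (ln r) N M.
Proof.
by move=> NLC MLC a0 b0 r0 /(limf_einf_expR_gt r0); exact: nat_dominates.
Qed.

Lemma rates_dominates (a b r : R) N M : 0 < a -> 0 < b -> 0 < r ->
  (r%:E < limf_einf (fun s : R =>
     (expR (rate N (b * s)) / expR (rate M (a * s)))%:E) +oo%R)%E ->
  dominates (ln r) N M.
Proof.
by move=> a0 b0 r0 /(limf_einf_expR_gt r0); exact: real_dominates.
Qed.

Lemma dominates_rates (r h : R) N M : 0 < r -> ln r < h -> dominates h N M ->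
  exists L : R, 0 < L /\ forall a b : R, 0 < a -> b = L * a ->
  (r%:E < limf_einf (fun s : R =>
     (expR (rate N (b * s)) / expR (rate M (a * s)))%:E) +oo%R)%E.
Proof.
move=> r0 rh /dominates_near[L [L0 H]]; exists L; split=> // a b a0 bE.
exact: near_limf_einf_expR r0 rh (H _ _ a0 bE).
Qed.

Lemma dominates_rates_nat (r h : R) N M : 0 < r -> ln r < h ->
  dominates h N M ->
  exists L : R, 0 < L /\ forall a b : R, 0 < a -> b = L * a ->
  (r%:E < limn_einf (fun j : nat =>
     (expR (rate N (b * j%:R)) / expR (rate M (a * j%:R)))%:E))%E.
Proof.
move=> r0 rh /dominates_near[L [L0 H]]; exists L; split=> // a b a0 bE.
apply: near_limf_einf_expR r0 rh _; exact: (cvgr_idn (H _ _ a0 bE)).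
Qed.

Lemma rate_ratio_mul (b s : R) N M :
  expR ((b * s)^-1 * phi_star (omega N) (b * s))
    / expR (s^-1 * phi_star (omega M) s) =
  expR (rate N (b * s)) / expR (rate M (1 * s)).
Proof. by rewrite mul1r. Qed.

Lemma rate_ratio_div (b s : R) N M :
  expR (s^-1 * phi_star (omega N) s)
    / expR (b / s * phi_star (omega M) (s / b)) =
  expR (rate N (1 * s)) / expR (rate M (b^-1 * s)).
Proof. by rewrite /rate mul1r [b^-1 * _]mulrC invf_div. Qed.

(** Stated for an abstract relation because the two halves of the theorem order M^x and M^y
    oppositely. *)
Lemma iterate_shift (D : R -> R -> R -> Prop) :
  (forall h k x y, h <= k -> D k x y -> D h x y) ->
  (forall h k x y z, D h x y -> D k y z -> D (h + k) x z) ->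
  (exists2 h, 0 < h & forall x, 0 < x -> exists y, 0 < y /\ D h x y) ->
  forall h x, 0 < x -> exists y, 0 < y /\ D h x y.
Proof.
move=> Dle Dtrans [k k0 Dk] h.
suff Dn n x : 0 < x -> exists y, 0 < y /\ D (n.+1%:R * k) x y.
  (* One step more than the integer part of h/k makes the accumulated shift exceed h. *)
  move=> x /(Dn (Num.truncn (h / k)))[y [y0 /Dle Dy]].
  by exists y; split=> //; apply: Dy; rewrite -ler_pdivrMr// ltW// truncnS_gt.
elim: n x => [|n IH] x x0; first by rewrite mul1r; exact: Dk.
have [y [y0 Dxy]] := IH x x0; have [z [z0 Dyz]] := Dk y y0.
exists z; split=> //; rewrite -natr1 mulrDl mul1r; exact: Dtrans Dxy Dyz.
Qed.
End LC.
Unset Implicit Arguments.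

(** * The two cycles of implications *)

Theorem theorem3p2 (R : realType) (M : R -> nat -> R)
    (hM : standard_log_convex M) :
  [<-> (forall h : R, 1 < h -> forall x : R, 0 < x -> exists y : R, 0 < y /\
          (limf_esup (fun t : R => (omega (M y) (h * t)
            / omega (M x) t)%:E) +oo%R < +oo)%E);
      (forall x : R, 0 < x -> exists y : R, 0 < y /\
          (limf_esup (fun t : R => (omega (M y) (2 * t)
            / omega (M x) t)%:E) +oo%R < +oo)%E);
      (exists r : R, 1 < r /\ forall x : R, 0 < x -> exists y : R, 0 < y /\
          exists L : nat, (0 < L)%N /\
          (r%:E < limn_einf (fun j : nat =>
            (M y (L * j)%N `^ ((L * j)%:R)^-1 / M x j `^ (j%:R)^-1)%:E))%E);
      (forall r : R, 1 < r -> forall x : R, 0 < x -> exists y : R, 0 < y /\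
          exists L : nat, (0 < L)%N /\
          (r%:E < limn_einf (fun j : nat =>
            (M y (L * j)%N `^ ((L * j)%:R)^-1 / M x j `^ (j%:R)^-1)%:E))%E);
      (forall x : R, 0 < x -> forall C : R, 1 < C -> exists y : R, 0 < y /\
          exists B : R, 0 < B /\ forall a : R, 0 < a -> exists D : R, 0 < D /\
          forall j : nat, C ^+ j * dual_seq (M x) a j <= D * dual_seq (M y) (B * a) j);
      (forall x : R, 0 < x -> forall C : R, 1 < C -> forall a : R, 0 < a ->
          exists y : R, 0 < y /\ exists b : R, 0 < b /\ exists D : R, 0 < D /\
          forall j : nat, C ^+ j * dual_seq (M x) a j <= D * dual_seq (M y) b j);
      (forall r : R, 1 < r -> forall x : R, 0 < x -> exists y : R, 0 < y /\
          exists b : R, 0 < b /\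
          (r%:E < limn_einf (fun j : nat =>
            (expR ((b * j%:R)^-1 * phi_star (omega (M y)) (b * j%:R))
             / expR ((j%:R)^-1 * phi_star (omega (M x)) j%:R))%:E))%E);
      (forall r : R, 1 < r -> forall x : R, 0 < x -> exists y : R, 0 < y /\
          exists b : R, 0 < b /\
          (r%:E < limf_einf (fun s : R =>
            (expR ((b * s)^-1 * phi_star (omega (M y)) (b * s))
             / expR (s^-1 * phi_star (omega (M x)) s))%:E) +oo%R)%E)] /\
  [<-> (forall h : R, 1 < h -> forall x : R, 0 < x -> exists y : R, 0 < y /\
          (limf_esup (fun t : R => (omega (M x) (h * t)
            / omega (M y) t)%:E) +oo%R < +oo)%E);
      (forall x : R, 0 < x -> exists y : R, 0 < y /\
          (limf_esup (fun t : R => (omega (M x) (2 * t)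
            / omega (M y) t)%:E) +oo%R < +oo)%E);
      (exists r : R, 1 < r /\ forall x : R, 0 < x -> exists y : R, 0 < y /\
          exists L : nat, (0 < L)%N /\
          (r%:E < limn_einf (fun j : nat =>
            (M x (L * j)%N `^ ((L * j)%:R)^-1 / M y j `^ (j%:R)^-1)%:E))%E);
      (forall r : R, 1 < r -> forall x : R, 0 < x -> exists y : R, 0 < y /\
          exists L : nat, (0 < L)%N /\
          (r%:E < limn_einf (fun j : nat =>
            (M x (L * j)%N `^ ((L * j)%:R)^-1 / M y j `^ (j%:R)^-1)%:E))%E);
      (forall x : R, 0 < x -> forall C : R, 1 < C -> exists y : R, 0 < y /\
          exists B : R, 0 < B /\ forall a : R, 0 < a -> exists D : R, 0 < D /\
          forall j : nat, C ^+ j * dual_seq (M y) (a / B) j <= D * dual_seq (M x) a j);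
      (forall x : R, 0 < x -> forall C : R, 1 < C -> forall a : R, 0 < a ->
          exists y : R, 0 < y /\ exists b : R, 0 < b /\ exists D : R, 0 < D /\
          forall j : nat, C ^+ j * dual_seq (M y) b j <= D * dual_seq (M x) a j);
      (forall r : R, 1 < r -> forall x : R, 0 < x -> exists y : R, 0 < y /\
          exists b : R, 0 < b /\
          (r%:E < limn_einf (fun j : nat =>
            (expR ((j%:R)^-1 * phi_star (omega (M x)) j%:R)
             / expR (b / j%:R * phi_star (omega (M y)) (j%:R / b)))%:E))%E);
      (forall r : R, 1 < r -> forall x : R, 0 < x -> exists y : R, 0 < y /\
          exists b : R, 0 < b /\
          (r%:E < limf_einf (fun s : R =>
            (expR (s^-1 * phi_star (omega (M x)) s)
             / expR (b / s * phi_star (omega (M y)) (s / b)))%:E) +oo%R)%E)].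
Proof.
have MLC x : 0 < x -> LC (M x) by case: hM => _; apply.
(* Doubling r supplies the strict gap lost when a domination becomes a strict limit inferior. *)
have ln_lt (r : R) : 1 < r -> ln r < ln (2 * r).
  by move=> r1; rewrite ltr_ln ?posrE; lra.
have ln2h : ln 2 / 2 < ln 2 :> R.
  by have : 0 < ln 2 :> R by [rewrite ln_gt0 ?ltr1n|]; lra.
have ln20 : 0 < ln 2 / 2 :> R by rewrite divr_gt0// ln_gt0 ?ltr1n.
split.
- have all_shifts : (exists2 h : R, 0 < h & forall x : R, 0 < x ->
        exists y, 0 < y /\ dominates h (M y) (M x)) ->
      forall h x : R, 0 < x -> exists y, 0 < y /\ dominates h (M y) (M x).
    apply: (iterate_shift (D := fun h x y => dominates h (M y) (M x))).
      by move=> h k x y; exact: dominates_le.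
    (* Here M^z dominates M^y, which dominates M^x, so the chain composes in reverse order. *)
    by move=> h k x y z xy yz; rewrite addrC; exact: dominates_trans yz xy.
  tfae=> H.
  + by apply: H; rewrite ltr1n.
  + have /all_shifts dom : exists2 h : R, 0 < h & forall x : R, 0 < x ->
        exists y, 0 < y /\ dominates h (M y) (M x).
      exists (ln 2 / 2) => // x x0; have [y [y0 fin]] := H x x0.
      exists y; split=> //.
      by apply: (omega_dominates _ _ _ ln2h fin); rewrite ?ltr1n; auto.
    exists 2; split; first by rewrite ltr1n.
    move=> x x0; have [y [y0 d]] := dom (ln (2 * 2)) x x0; exists y; split=> //.
    by apply: dominates_roots d; auto; apply: ln_lt; rewrite ltr1n.
  + have /all_shifts dom : exists2 h : R, 0 < h & forall x : R, 0 < x ->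
        exists y, 0 < y /\ dominates h (M y) (M x).
      have [r [r1 Hr]] := H; exists (ln r) => [|x x0]; first exact: ln_gt0.
      have [y [y0 [L [L0 lim]]]] := Hr x x0; exists y; split=> //.
      by apply: roots_dominates lim; auto; lra.
    move=> r r1 x x0; have [y [y0 d]] := dom (ln (2 * r)) x x0.
    by exists y; split=> //; apply: dominates_roots d; auto; lra.
  + move=> x x0 C C1; have [y [y0 [L [L0 lim]]]] := H C C1 x x0.
    exists y; split=> //; apply: dominates_dual; auto.
    by apply: roots_dominates lim; auto; lra.
  + move=> x x0 C C1 a a0; have [y [y0 [B [B0 HB]]]] := H x x0 C C1.
    by exists y; split=> //; exists (B * a); split; [exact: mulr_gt0|exact: HB].
  + move=> r r1 x x0.
    (* Starting from C = 4r allows two losses: ln(4r) drops to ln(2r) when [D] is absorbed, then to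
       ln r for the strict limit inferior. *)
    have [|y [y0 [b [b0 [D [D0 HD]]]]]] := H x x0 (2 * (2 * r)) _ 1 ltr01.
      by lra.
    have d : dominates (ln (2 * r)) (M y) (M x).
      by apply: (dual_dominates _ _ ltr01 b0 _ D0 _ HD); auto;
        [lra|apply: ln_lt; lra].
    have [|L [L0 HL]] := dominates_rates_nat _ (ln_lt r r1) d; first by lra.
    exists y; split=> //; exists L; split=> //.
    under eq_fun do rewrite rate_ratio_mul.
    by apply: HL; rewrite ?mulr1.
  + move=> r r1 x x0; have [|y [y0 [b [b0 lim]]]] := H (2 * r) _ x x0.
      by lra.
    have d : dominates (ln (2 * r)) (M y) (M x).
      move: lim; under eq_fun do rewrite rate_ratio_mul.
      by apply: rates_nat_dominates; auto; lra.
    have [|L [L0 HL]] := dominates_rates _ (ln_lt r r1) d; first by lra.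
    exists y; split=> //; exists L; split=> //.
    under eq_fun do rewrite rate_ratio_mul.
    by apply: HL; rewrite ?mulr1.
  + move=> h h1 x x0; have [y [y0 [b [b0 lim]]]] := H h h1 x x0.
    exists y; split=> //; apply: dominates_omega; auto.
    move: lim; under eq_fun do rewrite rate_ratio_mul.
    by apply: rates_dominates => //; lra.
(* The second half runs through the same cycle with M^x now dominating M^y. *)
- have all_shifts : (exists2 h : R, 0 < h & forall x : R, 0 < x ->
        exists y, 0 < y /\ dominates h (M x) (M y)) ->
      forall h x : R, 0 < x -> exists y, 0 < y /\ dominates h (M x) (M y).
    apply: (iterate_shift (D := fun h x y => dominates h (M x) (M y))).
      by move=> h k x y; exact: dominates_le.
    by move=> h k x y z; exact: dominates_trans.
  tfae=> H.
  + by apply: H; rewrite ltr1n.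
  + have /all_shifts dom : exists2 h : R, 0 < h & forall x : R, 0 < x ->
        exists y, 0 < y /\ dominates h (M x) (M y).
      exists (ln 2 / 2) => // x x0; have [y [y0 fin]] := H x x0.
      exists y; split=> //.
      by apply: (omega_dominates _ _ _ ln2h fin); rewrite ?ltr1n; auto.
    exists 2; split; first by rewrite ltr1n.
    move=> x x0; have [y [y0 d]] := dom (ln (2 * 2)) x x0; exists y; split=> //.
    by apply: dominates_roots d; auto; apply: ln_lt; rewrite ltr1n.
  + have /all_shifts dom : exists2 h : R, 0 < h & forall x : R, 0 < x ->
        exists y, 0 < y /\ dominates h (M x) (M y).
      have [r [r1 Hr]] := H; exists (ln r) => [|x x0]; first exact: ln_gt0.
      have [y [y0 [L [L0 lim]]]] := Hr x x0; exists y; split=> //.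
      by apply: roots_dominates lim; auto; lra.
    move=> r r1 x x0; have [y [y0 d]] := dom (ln (2 * r)) x x0.
    by exists y; split=> //; apply: dominates_roots d; auto; lra.
  + move=> x x0 C C1; have [y [y0 [L [L0 lim]]]] := H C C1 x x0.
    have d : dominates (ln C) (M x) (M y).
      by apply: roots_dominates lim; auto; lra.
    have [||//|B [B0 HB]] := dominates_dual _ _ _ d; auto.
    exists y; split=> //; exists B; split=> // a a0.
    (* The parameter a/B is chosen so that the dominating side M^x gets B (a/B) = a. *)
    have [D [D0 HD]] := HB (a / B) (divr_gt0 a0 B0).
    exists D; split=> // j; have := HD j.
    by rewrite [B * _]mulrC divfK ?gt_eqF.
  + move=> x x0 C C1 a a0; have [y [y0 [B [B0 HB]]]] := H x x0 C C1.
    by exists y; split=> //; exists (a / B); split; [exact: divr_gt0|exact: HB].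
  + move=> r r1 x x0.
    have [|y [y0 [b [b0 [D [D0 HD]]]]]] := H x x0 (2 * (2 * r)) _ 1 ltr01.
      by lra.
    have d : dominates (ln (2 * r)) (M x) (M y).
      by apply: (dual_dominates _ _ b0 ltr01 _ D0 _ HD); auto;
        [lra|apply: ln_lt; lra].
    have [|L [L0 HL]] := dominates_rates_nat _ (ln_lt r r1) d; first by lra.
    exists y; split=> //; exists L; split=> //.
    under eq_fun do rewrite rate_ratio_div.
    by apply: HL; rewrite ?invr_gt0// divff ?gt_eqF.
  + move=> r r1 x x0; have [|y [y0 [b [b0 lim]]]] := H (2 * r) _ x x0.
      by lra.
    have d : dominates (ln (2 * r)) (M x) (M y).
      move: lim; under eq_fun do rewrite rate_ratio_div.
      by apply: rates_nat_dominates; rewrite ?invr_gt0; auto; lra.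
    have [|L [L0 HL]] := dominates_rates _ (ln_lt r r1) d; first by lra.
    exists y; split=> //; exists L; split=> //.
    under eq_fun do rewrite rate_ratio_div.
    by apply: HL; rewrite ?invr_gt0// divff ?gt_eqF.
  + move=> h h1 x x0; have [y [y0 [b [b0 lim]]]] := H h h1 x x0.
    exists y; split=> //; apply: dominates_omega; auto.
    move: lim; under eq_fun do rewrite rate_ratio_div.
    by apply: rates_dominates; rewrite ?invr_gt0//; lra.
Qed.
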